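(* Let $x$ be fixed observed data, $p(x,z)$, $z\in\mathbb{R}^d$, a positive joint density differentiable in $z$, with $p(x):=\int p(x,z)\,dz$, and let $q$ be a probability density on $\mathbb{R}^d$; set $w(z):=p(x,z)/q(z)$. Let $\alpha\in[0,1)$, fix a point $z\in\mathbb{R}^d$ and a coordinate $r\in\{1,\dots,d\}$. For integers $M,K\ge1$ let $\{z_{m,j}:1\le m\le M,\ 1\le j\le K-1\}$ be i.i.d. with law $q$, put $g_m:=w(z)^{1-\alpha}/\big(\sum_{j=1}^{K-1}w(z_{m,j})^{1-\alpha}+w(z)^{1-\alpha}\big)$, and define $$g^r_{\alpha,M,K}(z):=\frac1M\sum_{m=1}^M\big(\alpha g_m+(1-\alpha)g_m^2\big)\frac{\partial}{\partial z_r}\log w(z),$$ with $\mathrm{SNR}(g^r_{\alpha,M,K}(z)):=|\mathbb{E}[g^r_{\alpha,M,K}(z)]|/\sqrt{\mathbb{V}[g^r_{\alpha,M,K}(z)]}$. Assume $\mathbb{E}_{Z\sim q}[w(Z)^{4(1-\alpha)}]<\infty$ and $\mathbb{E}_{Z\sim q}[w(Z)^{-12(1-\alpha)}]<\infty$. Then for any $z$ with $w(z)>0$, $$\mathrm{SNR}(g^r_{\alpha,M,K}(z))=\Omega(\sqrt{MK}),\qquad r=1,\dots,d.$$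
   Context: For positive quantities $a$ and $b$, $a=\Omega(b)$ means there is a constant $c>0$ with $a/b\ge c$ for all $K$ sufficiently large. The estimator is the Monte Carlo estimate of the $r$-th coordinate of the Wasserstein gradient of the VR-IWAE bound, $\mathbb{E}_{z_1,\dots,z_{K-1}\overset{i.i.d.}{\sim}q}\big[(\alpha g+(1-\alpha)g^2)\nabla_z\log w(z)\big]$ with $g=w(z)^{1-\alpha}/(\sum_{j=1}^{K-1}w(z_j)^{1-\alpha}+w(z)^{1-\alpha})$. *)

(* Defs.v *)
From HB Require Import structures.
From mathcomp Require Import all_boot all_order all_algebra.
From mathcomp Require Import all_classical all_reals all_analysis.
Set Implicit Arguments. Unset Strict Implicit. Unset Printing Implicit Defensive.
Import Order.TTheory GRing.Theory Num.Theory.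
Import numFieldNormedType.Exports.
Local Open Scope classical_set_scope.
Local Open Scope ring_scope.

Definition Rd (R : realType) (d : nat) := g_sigma_algebraType (@open 'rV[R]_d).

Definition box (R : realType) (d : nat) (a b : 'rV[R]_d) : set (Rd R d) :=
  [set x : 'rV[R]_d | forall i : 'I_d, a ord0 i <= x ord0 i <= b ord0 i].

(* lam is Lebesgue measure on the Borel sets of R^d: it gives every closed
   box its volume (this characterizes Lebesgue measure on Borel sets). *)
Definition is_lebesgue_Rd (R : realType) (d : nat)
    (lam : {measure set (Rd R d) -> \bar R}) : Prop :=
  forall a b : 'rV[R]_d, (forall i, a ord0 i <= b ord0 i) ->
    lam (box a b) = (\prod_(i < d) (b ord0 i - a ord0 i))%:E.

Definition is_prob_density (R : realType) (d : nat)
    (lam : {measure set (Rd R d) -> \bar R}) (q : 'rV[R]_d -> R) : Prop :=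
  [/\ forall z, 0 <= q z, measurable_fun setT (q : Rd R d -> R)
    & (\int[lam]_z (q z)%:E = 1)%E].

Definition has_density_law {dO} {Omega : measurableType dO} (R : realType)
    (d : nat) (P : probability Omega R) (lam : {measure set (Rd R d) -> \bar R})
    (q : 'rV[R]_d -> R) (X : Omega -> Rd R d) : Prop :=
  measurable_fun setT X /\
  forall A : set (Rd R d), measurable A ->
    P (X @^-1` A) = (\int[lam]_(x in A) (q x)%:E)%E.

Definition mutually_independent {dO dT} {Omega : measurableType dO}
    (R : realType) (P : probability Omega R) (I : finType)
    (T : measurableType dT) (X : I -> Omega -> T) : Prop :=
  forall (J : {set I}) (A : I -> set T),
    (forall i, i \in J -> measurable (A i)) ->
    P (\bigcap_(i in [set i | i \in J]) (X i @^-1` A i)) =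
      (\prod_(i in J) P (X i @^-1` A i))%E.

Definition iw (R : realType) (d : nat) (pxz q : 'rV[R]_d -> R) (z : 'rV[R]_d) : R :=
  pxz z / q z.

Definition vr_grad_estimator {dO} {Omega : measurableType dO} (R : realType)
    (d : nat) (pxz q : 'rV[R]_d -> R) (alpha : R) (z : 'rV[R]_d) (r : 'I_d)
    (M K : nat) (Z : 'I_M * 'I_K.-1 -> Omega -> Rd R d) : Omega -> R :=
  fun om =>
    let a := iw pxz q z `^ (1 - alpha) in
    let g m := a / (\sum_(j < K.-1) iw pxz q (Z (m, j) om) `^ (1 - alpha) + a) in
    M%:R^-1 * \sum_(m < M)
      ((alpha * g m + (1 - alpha) * g m ^+ 2) *
       'D_(delta_mx ord0 r) (fun y => ln (iw pxz q y)) z).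

Definition SNR {dO} {Omega : measurableType dO} (R : realType)
    (P : probability Omega R) (X : Omega -> R) : \bar R :=
  let e := fine ('E_P[X])%E in
  let v := fine (variance P X) in
  if 0 < v then (`|e| / Num.sqrt v)%:E else +oo%E.

(* Main.v *)
Require Import Defs.
From HB Require Import structures.
From mathcomp Require Import all_boot all_order all_algebra.
From mathcomp Require Import all_classical all_reals all_analysis.
From mathcomp Require Import measurable_realfun ring lra.
Import Order.TTheory GRing.Theory Num.Theory.
Import numFieldNormedType.Exports.
Local Open Scope classical_set_scope.
Local Open Scope ring_scope.
Set Implicit Arguments.
Unset Strict Implicit.

(**
Write [X_j = w(Z_j)^(1-al)], [n = K - 1], [S = X_1 + ... + X_n], [a = w(z)^(1-al)],
[mu = E X_1], [b = n mu + a], [rho = b / (S + a)], [g0 = a / b] and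
[h0 = al g0 + (1-al) g0^2], so that one summand of the estimator is
[h = mix al g = al g + (1-al) g^2] with [g = g0 rho].

Mean: the tangent lines [rho >= 1 + D/b] and [rho^2 >= 1 + 2 D/b], where
[D = b - (S + a) = n mu - S] is centered, give [E h >= h0].

Dispersion: [(h - h0)^2 <= h0^2 (rho^2 - 1)^2], and since
[rho^2 - 1 = rho (rho + 1) D / b], AM-GM bounds [(rho^2 - 1)^2] by a multiple of
[(1 + rho^8) / n + n (D / b)^4].  Jensen's inequality for [x^-8] bounds [E rho^8] by
[(mu + a)^8 E X_1^-8], and [E D^4 = O(n^2)] by independence, so that
[E (h - h0)^2 <= C h0^2 / n].

The [M] blocks are independent, so the variance of their average is at most
[C h0^2 / (n M)] while its mean is at least [h0].
*)

(** * Real inequalities *)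

(** As a function of [x], [y / x] is convex, so it lies above its tangent at [x = y]; the gap is
    [(y - x) ^+ 2 / (x * y)]. *)
Lemma ler_tangent_div {F : realFieldType} (x y : F) : 0 < x -> 0 < y ->
  1 + (y - x) / y <= y / x.
Proof.
move=> x0 y0; rewrite -subr_ge0.
have -> : y / x - (1 + (y - x) / y) = (y - x) ^+ 2 / (x * y).
  by field; rewrite !gt_eqF.
by rewrite divr_ge0 ?sqr_ge0 ?mulr_ge0 ?ltW.
Qed.

Lemma ler_tangent_div_sqr {F : realFieldType} (x y : F) : 0 < x -> 0 < y ->
  1 + 2 * ((y - x) / y) <= (y / x) ^+ 2.
Proof.
move=> x0 y0; have := ler_tangent_div x0 y0.
have := sqr_ge0 (y / x - 1); nra.
Qed.

(** Iterating [2 s - 1 <= s ^+ 2] three times from [t = y / x] gives [8 t - 7 <= t ^+ 8], and the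
    tangent of the reciprocal gives [2 - x / y <= t]. *)
Lemma ler_tangent_expV8 {F : realFieldType} (x y : F) : 0 < x -> 0 < y ->
  9 - 8 * (x / y) <= (y / x) ^+ 8.
Proof.
move=> x0 y0; have := ler_tangent_div x0 y0.
have -> : (y - x) / y = 1 - x / y by field; rewrite gt_eqF.
set t := y / x => ht.
have h2 : 2 * t - 1 <= t ^+ 2 by have := sqr_ge0 (t - 1); nra.
have h4 : 2 * t ^+ 2 - 1 <= t ^+ 4 by have := sqr_ge0 (t ^+ 2 - 1); nra.
have h8 : 2 * t ^+ 4 - 1 <= t ^+ 8 by have := sqr_ge0 (t ^+ 4 - 1); nra.
lra.
Qed.

(* Jensen's inequality, obtained by summing the tangent lines of [t ^- 8] at the mean. *)
Lemma jensen_expV8 {F : realFieldType} (I : finType) (x : I -> F) :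
  (0 < #|I|)%N -> (forall i, 0 < x i) ->
  #|I|%:R ^+ 9 / (\sum_i x i) ^+ 8 <= \sum_i (x i)^-1 ^+ 8.
Proof.
move=> I0 x0; set n : F := #|I|%:R; set S := \sum_i x i.
have n0 : 0 < n by rewrite ltr0n.
have [i0 _] : exists i : I, i \in I by apply/card_gt0P.
have S0 : 0 < S.
  rewrite /S (bigD1 i0)//= ltr_wpDr// sumr_ge0// => i _; exact: ltW.
pose m := S / n.
have m0 : 0 < m by rewrite divr_gt0.
have : \sum_i (9 - 8 * (x i / m)) <= \sum_i (m / x i) ^+ 8.
  by apply: ler_sum => i _; exact: ler_tangent_expV8.
rewrite big_split/= sumrN -mulr_sumr -mulr_suml -/S sumr_const -[_ *+ #|I|]mulr_natr -/n.
have -> : S / m = n by rewrite /m; field; rewrite !gt_eqF.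
have -> : \sum_i (m / x i) ^+ 8 = m ^+ 8 * \sum_i (x i)^-1 ^+ 8.
  by rewrite mulr_sumr; apply: eq_bigr => i _; rewrite exprMn.
have -> : 9%:R * n - 8 * n = n by ring.
move=> h.
have -> : n ^+ 9 / S ^+ 8 = n / m ^+ 8.
  by rewrite /m; field; rewrite !gt_eqF.
by rewrite ler_pdivrMr ?exprn_gt0// mulrC.
Qed.

(** The weights [n^-1] and [n] in AM-GM balance the two terms: when [x] is [a] plus a sum of [n]
    independent weights with mean [mu], the fourth power of [(b - x) / b] has expectation of order
    [n ^- 2], so both terms are of order [n^-1]. *)
Lemma sqr_ratio_bound {F : realFieldType} (n b x : F) : 0 < n -> 0 < b -> 0 < x ->
  ((b / x) ^+ 2 - 1) ^+ 2 <=
  8 * (n^-1 * (1 + (b / x) ^+ 8)) + n / 2 * ((b - x) / b) ^+ 4.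
Proof.
move=> n0 b0 x0; set r := b / x; set D := (b - x) / b.
have r0 : 0 < r by rewrite divr_gt0.
have -> : r ^+ 2 - 1 = r * (r + 1) * D.
  by rewrite /r /D; field; rewrite !gt_eqF.
set u := (r * (r + 1)) ^+ 2.
have -> : (r * (r + 1) * D) ^+ 2 = u * D ^+ 2 by rewrite exprMn.
(* From [(r + 1) ^+ 2 <= 2 (r ^+ 2 + 1)] and [2 r ^+ 2 <= 1 + r ^+ 4] comes [u <= 1 + 3 r ^+ 4];
   squaring and absorbing the middle term stays below the factor 16. *)
have hu : u ^+ 2 <= 16 * (1 + r ^+ 8).
  have h1 : u <= 1 + 3 * r ^+ 4.
    have -> : u = r ^+ 2 * (r + 1) ^+ 2 by rewrite /u exprMn.
    have : (r + 1) ^+ 2 <= 2 * (r ^+ 2 + 1) by have := sqr_ge0 (r - 1); nra.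
    have := sqr_ge0 (r ^+ 2 - 1); have := sqr_ge0 r.
    have -> : r ^+ 4 = r ^+ 2 * r ^+ 2 by ring.
    nra.
  have u0 : 0 <= u by rewrite sqr_ge0.
  have r8 : r ^+ 8 = r ^+ 4 * r ^+ 4 by ring.
  have r4 : 0 <= r ^+ 4 by rewrite exprn_ge0// ltW.
  have : u ^+ 2 <= (1 + 3 * r ^+ 4) ^+ 2 by rewrite ler_sqr ?nnegrE//; lra.
  have := sqr_ge0 (r ^+ 4 - 1); rewrite r8; nra.
(* AM-GM: [u D^2 <= (u^2 / n + n D^4) / 2] *)
have amgm : 2 * (u * D ^+ 2) <= n^-1 * u ^+ 2 + n * D ^+ 4.
  rewrite -subr_ge0.
  have -> : n^-1 * u ^+ 2 + n * D ^+ 4 - 2 * (u * D ^+ 2) =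
    n^-1 * (u - n * D ^+ 2) ^+ 2 by field; rewrite gt_eqF.
  by rewrite mulr_ge0 ?sqr_ge0// invr_ge0 ltW.
have : n^-1 * u ^+ 2 <= n^-1 * (16 * (1 + r ^+ 8)).
  by rewrite ler_wpM2l// invr_ge0 ltW.
lra.
Qed.

Definition mix {F : realFieldType} (al g : F) := al * g + (1 - al) * g ^+ 2.

(** With [rho = b / x], [mix al (a / x)] is a combination of [rho] and [rho ^+ 2] with nonnegative
    coefficients, so both tangent lines apply termwise. The correction is linear in [b - x] and
    disappears in expectation when [x] has mean [b]. *)
Lemma mix_lower_bound {F : realFieldType} (al a b x : F) :
  0 <= al -> al <= 1 -> 0 < a -> 0 < b -> 0 < x ->
  mix al (a / b) + (al * (a / b) + 2 * (1 - al) * (a / b) ^+ 2) * ((b - x) / b) <=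
  mix al (a / x).
Proof.
move=> al0 al1 a0 b0 x0; rewrite /mix; set gs := a / b.
have -> : a / x = gs * (b / x) by rewrite /gs; field; rewrite !gt_eqF.
have gs0 : 0 <= gs by rewrite divr_ge0 ?ltW.
have h1 : 0 <= al * gs * (b / x - (1 + (b - x) / b)).
  by apply: mulr_ge0; [exact: mulr_ge0|rewrite subr_ge0 ler_tangent_div].
have h2 : 0 <= (1 - al) * gs ^+ 2 * ((b / x) ^+ 2 - (1 + 2 * ((b - x) / b))).
  apply: mulr_ge0; first by rewrite mulr_ge0 ?sqr_ge0 ?subr_ge0.
  by rewrite subr_ge0 ler_tangent_div_sqr.
rewrite -subr_ge0; set lhs := (X in 0 <= X).
suff -> : lhs = al * gs * (b / x - (1 + (b - x) / b)) +
    (1 - al) * gs ^+ 2 * ((b / x) ^+ 2 - (1 + 2 * ((b - x) / b))).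
  exact: addr_ge0.
by rewrite /lhs; ring.
Qed.

(** The difference factors as [(al gs + (1 - al) gs ^+ 2 (r + 1)) (r - 1)]. The first factor is at
    most [hs (r + 1)], the defect being [al gs r], and [(r + 1) (r - 1) = r ^+ 2 - 1]. *)
Lemma mix_dist_bound {F : realFieldType} (al a b x : F) :
  0 <= al -> al <= 1 -> 0 < a -> 0 < b -> 0 < x ->
  (mix al (a / x) - mix al (a / b)) ^+ 2 <=
  mix al (a / b) ^+ 2 * ((b / x) ^+ 2 - 1) ^+ 2.
Proof.
move=> al0 al1 a0 b0 x0; rewrite /mix; set gs := a / b.
set hs := al * gs + _ * gs ^+ 2.
have gs0 : 0 <= gs by rewrite divr_ge0 ?ltW.
have al1' : 0 <= 1 - al by rewrite subr_ge0.
have gs20 : 0 <= gs ^+ 2 by rewrite sqr_ge0.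
have hs0 : 0 <= hs by rewrite addr_ge0// mulr_ge0.
have -> : a / x = gs * (b / x) by rewrite /gs; field; rewrite !gt_eqF.
set r := b / x; have r0 : 0 < r by rewrite divr_gt0.
have -> : al * (gs * r) + (1 - al) * (gs * r) ^+ 2 - hs =
  (al * gs + (1 - al) * gs ^+ 2 * (r + 1)) * (r - 1) by rewrite /hs; ring.
have -> : r ^+ 2 - 1 = (r + 1) * (r - 1) by ring.
have -> : hs ^+ 2 * ((r + 1) * (r - 1)) ^+ 2 = (hs * (r + 1)) ^+ 2 * (r - 1) ^+ 2.
  by ring.
rewrite [leLHS]exprMn ler_wpM2r ?sqr_ge0// ler_sqr ?nnegrE.
- rewrite -subr_ge0 (_ : _ - _ = al * gs * r); last by rewrite /hs; ring.
  by apply: mulr_ge0 (ltW r0); exact: mulr_ge0.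
- by rewrite addr_ge0 ?(mulr_ge0 al0)// mulr_ge0 ?(mulr_ge0 al1')// addr_ge0// ltW.
- by rewrite mulr_ge0// addr_ge0// ltW.
Qed.

(** * Independence *)

Section independence.
Context {R : realType} {dO : measure_display} {Omega : measurableType dO}.
Variable P : probability Omega R.

Definition indep_set_systems (G H : set (set Omega)) :=
  forall A B, G A -> H B -> P (A `&` B) = (P A * P B)%E.

Lemma indep_set_systemsC G H : indep_set_systems G H -> indep_set_systems H G.
Proof. by move=> GH A B HA GB; rewrite setIC GH// muleC. Qed.

(** For a fixed [B] in [H], the restriction of [P] to [B] and the multiple of [P] by [P B] are
    finite measures that agree on the pi-system [G], hence on the sigma-algebra it generates. *)
Lemma indep_g_sigma_algebral G H :
  setI_closed G -> G setT -> G `<=` measurable -> H `<=` measurable ->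
  indep_set_systems G H -> indep_set_systems <<s G >> H.
Proof.
move=> GI GT Gm Hm GH A B sGA HB.
have mB := Hm _ HB.
have PB0 : 0 <= fine (P B) by rewrite fine_ge0.
pose m1 : {measure set Omega -> \bar R} := mrestr P mB.
pose m2 : {measure set Omega -> \bar R} := mscale (NngNum PB0) P.
have : m1 A = m2 A.
  apply: (g_sigma_algebra_measure_unique G _ (fun _ : nat => setT)) => //.
  - by rewrite bigcup_const.
  - move=> C GC; rewrite /m1 /m2 /= /mrestr /mscale /=.
    by rewrite GH// fineK ?fin_num_measure// muleC.
  - by move=> _; rewrite /m1 /= /mrestr setTI ltey_eq fin_num_measure.
by rewrite /m1 /m2 /= /mrestr /mscale /= fineK ?fin_num_measure// muleC.
Qed.

Lemma indep_g_sigma_algebra G H :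
  setI_closed G -> G setT -> G `<=` measurable ->
  setI_closed H -> H setT -> H `<=` measurable ->
  indep_set_systems G H -> indep_set_systems <<s G >> <<s H >>.
Proof.
move=> GI GT Gm HI HT Hm GH; apply: indep_g_sigma_algebral => //.
  by apply: smallest_sub => //; exact: sigma_algebra_measurable.
apply/indep_set_systemsC/indep_g_sigma_algebral => //.
exact: indep_set_systemsC.
Qed.

Definition indep_real (f g : Omega -> R) :=
  forall A B, measurable A -> measurable B ->
    P (f @^-1` A `&` g @^-1` B) = (P (f @^-1` A) * P (g @^-1` B))%E.

(** * Independence of functions of disjoint blocks of coordinates *)

Section cylinders.
Context {dT : measure_display} {T : measurableType dT} {I : finType}.
Variable X : I -> Omega -> T.
Hypothesis mX : forall i, measurable_fun setT (X i).
Hypothesis indepX : mutually_independent P X.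

(** These sets form a pi-system generating the sigma-algebra of the coordinates in [J]. *)
Definition cylinder (J : {set I}) : set (set Omega) :=
  [set E | exists2 A : I -> set T, (forall i, measurable (A i)) &
     E = \bigcap_(i in [set i | i \in J]) (X i @^-1` A i)].

Lemma cylinder_setI_closed J : setI_closed (cylinder J).
Proof.
move=> _ _ [A mA ->] [B mB ->]; exists (fun i => A i `&` B i).
  by move=> i; exact: measurableI.
by rewrite -bigcapI.
Qed.

Lemma cylinder_setT J : cylinder J setT.
Proof.
by exists (fun=> setT) => //; apply/seteqP; split.
Qed.

Lemma cylinder_measurable J : cylinder J `<=` measurable.
Proof.
move=> _ [A mA ->]; apply: fin_bigcap_measurable => // i _.
by rewrite -[X in measurable X]setTI; exact: mX.
Qed.

Lemma indep_cylinder (J J' : {set I}) : (forall i, i \in J -> i \notin J') ->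
  indep_set_systems (cylinder J) (cylinder J').
Proof.
move=> JJ' _ _ [A mA ->] [B mB ->].
(* Since [J] and [J'] are disjoint, one family [C] describes both cylinders; mutual independence on
   the union then splits the product in two. *)
pose C i := if i \in J then A i else B i.
have CJ' i : i \in J' -> C i = B i.
  move=> iJ'; rewrite /C ifF//; apply: contraTF iJ'; exact: JJ'.
have mC i : measurable (C i) by rewrite /C; case: ifP.
have -> : \bigcap_(i in [set i | i \in J]) (X i @^-1` A i) =
          \bigcap_(i in [set i | i \in J]) (X i @^-1` C i).
  by apply: eq_bigcapr => i /= iJ; rewrite /C iJ.
have -> : \bigcap_(i in [set i | i \in J']) (X i @^-1` B i) =
          \bigcap_(i in [set i | i \in J']) (X i @^-1` C i).
  by apply: eq_bigcapr => i /= iJ; rewrite CJ'.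
rewrite -bigcap_setU.
have -> : [set i | i \in J] `|` [set i | i \in J'] =
    [set i | i \in J :|: J'].
  by apply/seteqP; split=> i /=; rewrite finset.in_setU => /orP.
rewrite !indepX//.
rewrite (bigID (mem J))/=; congr (_ * _)%E; apply: eq_bigl => i.
  by rewrite finset.in_setU; case: (i \in J) => //; rewrite andbF.
rewrite finset.in_setU; have := @JJ' i; case: (i \in J) => /= [/(_ isT)/negbTE->//|_].
by rewrite andbT.
Qed.

(** The sample space is given the coarser sigma-algebra of the block, so the usual closure
    properties of measurable functions show that a function depends on the coordinates in [J]
    only. *)
Definition block_measurable (J : {set I}) (f : Omega -> R) :=
  measurable_fun [set: g_sigma_algebraType (cylinder J)] f.

Lemma block_measurable_coord (J : {set I}) i : i \in J ->
  @measurable_fun _ _ (g_sigma_algebraType (cylinder J)) T setT (X i).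
Proof.
move=> iJ _ A mA; rewrite setTI; apply: sub_sigma_algebra.
exists (fun k => if k == i then A else setT).
  by move=> k; case: ifP.
apply/seteqP; split => [om /= AX k _|om /(_ i iJ)] /=.
  by case: ifPn => // /eqP ->.
by rewrite eqxx.
Qed.

Lemma block_measurable_sum (J : {set I}) (K : finType) (A : {set K})
    (f : K -> Omega -> R) :
  (forall k, k \in A -> block_measurable J (f k)) ->
  block_measurable J (fun x => \sum_(k in A) f k x).
Proof.
move=> mf; have -> : (fun x => \sum_(k in A) f k x) =
    (fun x => \sum_k if k \in A then f k x else 0).
  by apply/funext => x; rewrite big_mkcond.
by apply: measurable_sum => k; case: (boolP (k \in A)) => [/mf|_].
Qed.

(** It serves twice: for the weights inside one block of the estimator, and for the [M] blocks among
    themselves. *)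
Lemma indep_block (J J' : {set I}) f g : (forall i, i \in J -> i \notin J') ->
  block_measurable J f -> block_measurable J' g -> indep_real f g.
Proof.
move=> JJ' mf mg A B mA mB.
apply: (indep_g_sigma_algebra (@cylinder_setI_closed J) (cylinder_setT J)
  (@cylinder_measurable J) (@cylinder_setI_closed J') (cylinder_setT J')
  (@cylinder_measurable J') (indep_cylinder JJ')).
- by rewrite -[X in _ X]setTI; exact: mf.
- by rewrite -[X in _ X]setTI; exact: mg.
Qed.

End cylinders.
End independence.

(** * Expectation of a product of independent variables *)

Section indep_mul.
Context {R : realType} {dO : measure_display} {Omega : measurableType dO}.
Variable P : probability Omega R.

Lemma indep_real_integrable_mul (f g : Omega -> R) : indep_real P f g ->
  P.-integrable setT (EFin \o f) -> P.-integrable setT (EFin \o g) ->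
  P.-integrable setT (EFin \o (f \* g)) /\
  \int[P]_x (f x * g x) = (\int[P]_x f x) * (\int[P]_x g x).
Proof.
move=> fg intf intg.
have mf : measurable_fun setT f by exact/measurable_EFinP/(measurable_int P intf).
have mg : measurable_fun setT g by exact/measurable_EFinP/(measurable_int P intg).
pose F : {mfun Omega >-> R} := HB.pack f (isMeasurableFun.Build _ _ _ _ f mf).
pose G : {mfun Omega >-> R} := HB.pack g (isMeasurableFun.Build _ _ _ _ g mg).
have mH : measurable_fun setT (fun x => (f x, g x)) by exact: measurable_fun_pair.
pose H : {mfun Omega >-> (R * R)%type} :=
  HB.pack (fun x => (f x, g x)) (isMeasurableFun.Build _ _ _ _ _ mH).
pose mu1 := distribution P F; pose mu2 := distribution P G.
(* Independence makes the joint law of [f] and [g] agree with the product of the marginals on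
   rectangles, hence everywhere. *)
have prodE X : measurable X -> (mu1 \x mu2)%E X = distribution P H X.
  apply: product_measure_unique => A B mA mB.
  rewrite /mu1 /mu2 /distribution /pushforward /= -fg//.
have mM : measurable_fun setT (fun z : R * R => (z.1 * z.2)%:E).
  apply/measurable_EFinP; exact: measurable_funM.
have mid : measurable_fun [set: R] (EFin : R -> \bar R).
  by apply/measurable_EFinP.
have intX1 : mu1.-integrable setT EFin.
  apply: integrable_pushforward => //.
have intX2 : mu2.-integrable setT EFin.
  apply: integrable_pushforward => //.
have E1 : (\int[mu1]_x x%:E = (\int[P]_x f x)%:E)%E.
  rewrite integral_distribution//= /Rintegral fineK//; exact: integrable_fin_num.
have E2 : (\int[mu2]_x x%:E = (\int[P]_x g x)%:E)%E.
  rewrite integral_distribution//= /Rintegral fineK//; exact: integrable_fin_num.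
(* By Tonelli, the integral of [|z.1 * z.2|] is the product of two finite first absolute moments. *)
have intM : (mu1 \x mu2)%E.-integrable setT (fun z : R * R => (z.1 * z.2)%:E).
  apply/integrable12ltyP => //=.
  have fin1 := integrable_fin_num measurableT (integrable_abse intX1).
  have fin2 := integrable_fin_num measurableT (integrable_abse intX2).
  under eq_integral => x _.
    under eq_integral do rewrite normrM EFinM.
    rewrite ge0_integralZl//; last exact: measurableT_comp.
    over.
  rewrite /= ge0_integralZr//; last 2 first.
  - exact: measurableT_comp.
  - exact: integral_ge0.
  by rewrite -ge0_fin_numE ?fin_numM// mule_ge0// integral_ge0.
have eqH (h : R * R -> \bar R) :
    (\int[distribution P H]_z h z = \int[(mu1 \x mu2)%E]_z h z)%E.
  apply: eq_measure_integral => A mA _; apply: esym; exact: prodE.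
have intfg : P.-integrable setT (EFin \o (f \* g)).
  apply/integrableP; split; first by apply/measurable_EFinP; exact: measurable_funM.
  have /integrableP[_] := intM; rewrite -eqH ge0_integral_distribution//.
  exact: measurableT_comp.
split => //.
apply: EFin_inj.
rewrite EFinM -E1 {1}/Rintegral fineK; last exact: integrable_fin_num.
rewrite -(integral_distribution (X:=H) mM)// eqH -integral12_prod_meas1//.
rewrite /fubini_F /=.
under eq_integral => x _.
  under eq_integral do rewrite EFinM.
  rewrite integralZl// E2.
  over.
by rewrite /= integralZr.
Qed.
End indep_mul.

(** * Moments of sums of independent random variables *)

Section real_integrable.
Context {R : realType} {dO : measure_display} {Omega : measurableType dO}.
Variable P : probability Omega R.

Definition L1fun (f : Omega -> R) := P.-integrable setT (EFin \o f).

Lemma L1fun_measurable f : L1fun f -> measurable_fun setT f.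
Proof. by move=> /measurable_int/measurable_EFinP. Qed.

Lemma L1fun_cst c : L1fun (fun=> c).
Proof. exact: finite_measure_integrable_cst. Qed.

Lemma L1funD f g : L1fun f -> L1fun g -> L1fun (fun x => f x + g x).
Proof.
move=> If Ig; have := integrableD measurableT If Ig.
by apply: eq_integrable => // x _.
Qed.

Lemma L1funZ c f : L1fun f -> L1fun (fun x => c * f x).
Proof.
move=> If; have := integrableZl measurableT c If.
by apply: eq_integrable => // x _.
Qed.

Lemma L1fun_sum (I : finType) (J : {set I}) (f : I -> Omega -> R) :
  (forall i, i \in J -> L1fun (f i)) -> L1fun (fun x => \sum_(i in J) f i x).
Proof.
move=> If; have := integrable_sum measurableT (index_enum I) If.
by apply: eq_integrable => // x _; rewrite /= sumEFin.
Qed.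

Lemma L1fun_le (f g : Omega -> R) : measurable_fun setT f -> L1fun g ->
  (forall x, `|f x| <= g x) -> L1fun f.
Proof.
move=> mf Ig fg; apply: (le_integrable measurableT _ _ Ig) => /=.
  exact/measurable_EFinP.
by move=> x _; rewrite lee_fin (le_trans (fg x))// ler_norm.
Qed.

Lemma L1fun_bounded (f : Omega -> R) c : measurable_fun setT f -> (forall x, `|f x| <= c) ->
  L1fun f.
Proof. by move=> mf fc; apply: L1fun_le (L1fun_cst c) fc. Qed.

Lemma L1fun_RintegralD (f g : Omega -> R) : L1fun f -> L1fun g ->
  \int[P]_x (f x + g x) = \int[P]_x f x + \int[P]_x g x.
Proof. exact: RintegralD. Qed.

Lemma L1fun_RintegralB (f g : Omega -> R) : L1fun f -> L1fun g ->
  \int[P]_x (f x - g x) = \int[P]_x f x - \int[P]_x g x.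
Proof. exact: RintegralB. Qed.

Lemma L1fun_RintegralZ c (f : Omega -> R) : L1fun f ->
  \int[P]_x (c * f x) = c * \int[P]_x f x.
Proof. exact: RintegralZl. Qed.

Lemma le_L1fun_Rintegral (f g : Omega -> R) : L1fun f -> L1fun g ->
  (forall x, f x <= g x) -> \int[P]_x f x <= \int[P]_x g x.
Proof. by move=> If Ig fg; apply: le_Rintegral. Qed.

Lemma Rintegral_prob_cst c : \int[P]_x c = c.
Proof. by rewrite /Rintegral/= integral_cst//= probability_setT mule1. Qed.

Lemma Rintegral_sum (I : finType) (J : {set I}) (f : I -> Omega -> R) :
  (forall i, L1fun (f i)) ->
  \int[P]_x (\sum_(i in J) f i x) = \sum_(i in J) \int[P]_x f i x.
Proof.
move=> If; rewrite /Rintegral.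
under eq_integral do rewrite -sumEFin.
rewrite (integral_sum measurableT (fun i => If i)).
under eq_bigr => i _ do
  rewrite -(fineK (integrable_fin_num measurableT (If i))).
by rewrite sumEFin.
Qed.

(** The domination is [|f| ^+ m <= 1 + |f| ^+ n], and constants are integrable for a probability. *)
Lemma L1fun_expr_le (f : Omega -> R) (m n : nat) : (m <= n)%N -> measurable_fun setT f ->
  L1fun (fun x => `|f x| ^+ n) -> L1fun (fun x => f x ^+ m).
Proof.
move=> mn mf If.
apply: (L1fun_le _ (L1funD (L1fun_cst 1) If)).
  exact: measurable_funX.
move=> x; rewrite normrX; have [h|h] := leP `|f x| 1.
  by rewrite (le_trans (exprn_ile1 m (normr_ge0 _) h))// lerDl exprn_ge0.
by rewrite (le_trans (ler_weXn2l (ltW h) mn))// lerDr.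
Qed.

Lemma indep_real_comp (f g : Omega -> R) (phi psi : R -> R) :
  measurable_fun setT phi -> measurable_fun setT psi ->
  indep_real P f g -> indep_real P (phi \o f) (psi \o g).
Proof.
move=> mphi mpsi fg A B mA mB; apply: (fg (phi @^-1` A) (psi @^-1` B)).
  by rewrite -[X in measurable X]setTI; exact: mphi.
by rewrite -[X in measurable X]setTI; exact: mpsi.
Qed.

Lemma indep_real_integrable_exprM (f g : Omega -> R) m n : indep_real P f g ->
  L1fun (fun x => f x ^+ m) -> L1fun (fun x => g x ^+ n) ->
  L1fun (fun x => f x ^+ m * g x ^+ n) /\
  \int[P]_x (f x ^+ m * g x ^+ n) =
    (\int[P]_x f x ^+ m) * (\int[P]_x g x ^+ n).
Proof.
move=> fg If Ig; apply: indep_real_integrable_mul => //.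
by apply: (indep_real_comp (phi := fun x => x ^+ m) (psi := fun x => x ^+ n)).
Qed.

End real_integrable.

Lemma finset_ind (I : finType) (K : {set I} -> Prop) : K finset.set0 ->
  (forall i (J : {set I}), i \notin J -> K J -> K (i |: J)%SET) -> forall J, K J.
Proof.
move=> K0 KU J; have [n] := ubnP #|J|; elim: n J => // n IH J.
have [->//|[i iJ]] := finset.set_0Vmem J.
rewrite (cardsD1 i) iJ ltnS => Jn; rewrite -(finset.setD1K iJ).
by apply: KU; [rewrite finset.setD11|exact: IH].
Qed.

Section moments.
Context {R : realType} {dO : measure_display} {Omega : measurableType dO}.
Variable P : probability Omega R.
Context {I : finType}.
Variable Y : I -> Omega -> R.
Local Notation T J := (fun x => \sum_(i in J : {set I}) Y i x).
Local Notation S J x := (\sum_(i in J : {set I}) Y i x).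
Hypothesis indepY : forall (J : {set I}) i, i \notin J -> indep_real P (T J) (Y i).
Hypothesis mY : forall i, measurable_fun setT (Y i).
Hypothesis EY : forall i, \int[P]_x Y i x = 0.

Let mT J : measurable_fun setT (T J).
Proof.
under eq_fun do rewrite -big_enum/=; apply: measurable_sum => i; exact: mY.
Qed.

Let Tsetu1 (J : {set I}) i x : i \notin J ->
  \sum_(k in (i |: J)%SET) Y k x = \sum_(k in J) Y k x + Y i x.
Proof. by move=> iJ; rewrite big_setU1//= addrC. Qed.

Let T0 x : S finset.set0 x = 0.
Proof. by rewrite big_set0. Qed.

(** Terms are added one at a time, each independent of the partial sum before it; the cross term
    [2 T Y] has expectation zero, so second moments add up. *)
Lemma sum_second_moment v :
  (forall i, L1fun P (fun x => Y i x ^+ 2)) ->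
  (forall i, \int[P]_x Y i x ^+ 2 <= v) ->
  forall J, [/\ L1fun P (T J), L1fun P (fun x => S J x ^+ 2), \int[P]_x S J x = 0 &
    \int[P]_x S J x ^+ 2 <= #|J|%:R * v].
Proof.
move=> IY2 EY2.
have IY i : L1fun P (Y i).
  apply: (L1fun_expr_le (m := 1) (n := 2)) => //.
  by under eq_fun do rewrite real_normK ?num_real//; exact: IY2.
apply: finset_ind => [|i J iJ [IT IT2 ET ET2]].
  split; try by under eq_fun do rewrite T0 ?expr0n/=; exact: L1fun_cst.
    by under eq_Rintegral do rewrite T0; rewrite Rintegral_prob_cst.
  under eq_Rintegral do rewrite T0 expr0n/=.
  by rewrite Rintegral_prob_cst cards0 mul0r.
have [IM EM] := indep_real_integrable_mul (indepY iJ) IT (IY i).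
have TE x : S (i |: J)%SET x ^+ 2 = S J x ^+ 2 + (2 * (S J x * Y i x) + Y i x ^+ 2).
  by rewrite Tsetu1//; ring.
have I2 : L1fun P (fun x => 2 * (S J x * Y i x) + Y i x ^+ 2).
  by apply: L1funD => //; exact: L1funZ.
split.
- by under eq_fun do rewrite Tsetu1//; exact: L1funD.
- by under eq_fun do rewrite TE; exact: L1funD.
- under eq_Rintegral do rewrite Tsetu1//.
  by rewrite L1fun_RintegralD// ET EY addr0.
- under eq_Rintegral do rewrite TE.
  rewrite !L1fun_RintegralD ?L1fun_RintegralZ ?EM ?EY//; try exact: L1funZ.
  have -> : #|(i |: J)%SET|%:R = 1 + #|J|%:R :> R by rewrite cardsU1 iJ natrD.
  by rewrite !mulr0 add0r mulrDl mul1r addrC lerD.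
Qed.

(** In the expansion of [(T + Y) ^+ 4] the terms [T ^+ 3 Y] and [T Y ^+ 3] have mean zero. With [k]
    terms already summed, the induction closes because [3 k ^+ 2 + 6 k + 1 <= 3 (k + 1) ^+ 2]. *)
Lemma sum_fourth_moment v : 0 <= v ->
  (forall i, L1fun P (fun x => Y i x ^+ 4)) ->
  (forall i, \int[P]_x Y i x ^+ 2 <= v) ->
  (forall i, \int[P]_x Y i x ^+ 4 <= v ^+ 2) ->
  forall J, L1fun P (fun x => S J x ^+ 4) /\
    \int[P]_x S J x ^+ 4 <= 3 * #|J|%:R ^+ 2 * v ^+ 2.
Proof.
move=> v0 IY4 EY2 EY4.
have norm4 (y : R) : `|y| ^+ 4 = y ^+ 4.
  by rewrite -normrX ger0_norm// (exprM y 2 2) sqr_ge0.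
have L4 (f : Omega -> R) m : (m <= 4)%N -> measurable_fun setT f ->
    L1fun P (fun x => f x ^+ 4) -> L1fun P (fun x => f x ^+ m).
  move=> m4 mf If; apply: (L1fun_expr_le m4) => //.
  by under eq_fun do rewrite norm4.
have IY i m : (m <= 4)%N -> L1fun P (fun x => Y i x ^+ m) by move=> m4; exact: L4.
have T2 := sum_second_moment (fun i => IY i 2 isT) EY2.
apply: finset_ind => [|i J iJ [IT4 ET4]].
  split; first by under eq_fun do rewrite T0 expr0n/=; exact: L1fun_cst.
  under eq_Rintegral do rewrite T0 expr0n/=.
  by rewrite Rintegral_prob_cst cards0 expr0n/= mulr0 mul0r.
have IT m : (m <= 4)%N -> L1fun P (fun x => S J x ^+ m) by move=> m4; exact: L4.
have IM m n (m4 : (m <= 4)%N) (n4 : (n <= 4)%N) :=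
  indep_real_integrable_exprM (indepY iJ) (IT m m4) (IY i n n4).
have [I31 E31] := IM 3 1 isT isT.
have [I22 E22] := IM 2 2 isT isT.
have [I13 E13] := IM 1 3 isT isT.
have [_ _ ET1 ET2] := T2 J.
have TE x : S (i |: J)%SET x ^+ 4 = S J x ^+ 4 + (4 * (S J x ^+ 3 * Y i x ^+ 1) +
    (6 * (S J x ^+ 2 * Y i x ^+ 2) + (4 * (S J x ^+ 1 * Y i x ^+ 3) + Y i x ^+ 4))).
  by rewrite Tsetu1//; ring.
have I1 : L1fun P (fun x => 4 * (S J x ^+ 1 * Y i x ^+ 3) + Y i x ^+ 4).
  by apply: L1funD; [exact: L1funZ|exact: IY4].
have I2 := L1funD (L1funZ 6 I22) I1.
have I3 := L1funD (L1funZ 4 I31) I2.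
split; first by under eq_fun do rewrite TE; exact: L1funD.
under eq_Rintegral do rewrite TE.
rewrite L1fun_RintegralD// L1fun_RintegralD//; last exact: L1funZ.
rewrite L1fun_RintegralD//; last exact: L1funZ.
rewrite L1fun_RintegralD//; last exact: L1funZ.
rewrite !L1fun_RintegralZ// E31 E22 E13.
have -> : \int[P]_x Y i x ^+ 1 = 0.
  by rewrite -[RHS](EY i); apply: eq_Rintegral => x _; rewrite expr1.
have -> : \int[P]_x S J x ^+ 1 = 0.
  by rewrite -[RHS]ET1; apply: eq_Rintegral => x _; rewrite expr1.
have -> : #|(i |: J)%SET|%:R = 1 + #|J|%:R :> R by rewrite cardsU1 iJ natrD.
rewrite mulr0 mul0r !mulr0 !add0r.
have := EY4 i; have := EY2 i.
have : 0 <= \int[P]_x Y i x ^+ 2 by apply: Rintegral_ge0 => x _; exact: sqr_ge0.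
have : 0 <= \int[P]_x S J x ^+ 2 by apply: Rintegral_ge0 => x _; exact: sqr_ge0.
move: ET4 ET2; set t4 := \int[P]_x S J x ^+ 4; set t2 := \int[P]_x S J x ^+ 2.
set y2 := \int[P]_x Y i x ^+ 2; set y4 := \int[P]_x Y i x ^+ 4; set k : R := #|J|%:R.
move=> ht4 ht2 t20 y20 hy2 hy4.
have : t2 * y2 <= k * v * v by apply: ler_pM.
have : 0 <= k by []. have : 0 <= v ^+ 2 by rewrite sqr_ge0.
nra.
Qed.
End moments.

(** * One block of weights *)

(** On nonnegative reals inversion is the real power with exponent -1, even at 0, where both give
    0. *)
Lemma measurable_fun_invr_ge0 {R : realType} {d} {T : measurableType d}
  (f : T -> R) : measurable_fun setT f -> (forall x, 0 <= f x) ->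
  measurable_fun setT (fun x => (f x)^-1).
Proof.
move=> mf f0.
under eq_fun => x do rewrite -powR_inv1 ?f0//.
exact: (measurableT_comp (f := fun y : R => y `^ (-1))).
Qed.

Lemma measurable_mix {R : realType} (al : R) : measurable_fun setT (mix al).
Proof. by apply: measurable_funD; apply: measurable_funM. Qed.

Lemma mix_ge0 {R : realType} (al g : R) : 0 <= al -> al <= 1 -> 0 <= g ->
  0 <= mix al g.
Proof.
by move=> al0 al1 g0; rewrite addr_ge0 ?mulr_ge0// ?sqr_ge0// subr_ge0.
Qed.

Lemma mix_le1 {R : realType} (al g : R) : 0 <= al -> al <= 1 -> 0 <= g ->
  g <= 1 -> mix al g <= 1.
Proof.
move=> al0 al1 g0 g1; have : g ^+ 2 <= 1 by rewrite exprn_ile1.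
rewrite /mix; nra.
Qed.

Section block_moments.
Context {R : realType} {dO : measure_display} {Omega : measurableType dO}.
Variable P : probability Omega R.
Context {I : finType}.
Variables (W : I -> Omega -> R) (mu kappa nu al a : R).
Hypothesis I0 : (0 < #|I|)%N.
Hypothesis mW : forall i, measurable_fun setT (W i).
Hypothesis W0 : forall i x, 0 <= W i x.
Hypothesis indepW : forall (J : {set I}) i, i \notin J ->
  indep_real P (fun x => \sum_(k in J) (W k x - mu)) (fun x => W i x - mu).
Hypothesis IW4 : forall i, L1fun P (fun x => W i x ^+ 4).
Hypothesis EW : forall i, \int[P]_x W i x = mu.
Hypothesis EW4 : forall i, \int[P]_x W i x ^+ 4 <= kappa.
Hypothesis IWV8 : forall i, L1fun P (fun x => (W i x)^-1 ^+ 8).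
Hypothesis EWV8 : forall i, \int[P]_x (W i x)^-1 ^+ 8 <= nu.
Hypothesis PW0 : forall i, P (W i @^-1` [set 0]) = 0%E.
Hypotheses (mu0 : 0 < mu) (a0 : 0 < a) (al0 : 0 <= al) (al1 : al <= 1).

Local Notation n := (#|I|%:R : R).
Local Notation S x := (\sum_i W i x).
Local Notation b := (n * mu + a).
Local Notation h x := (mix al (a / (S x + a))).
Local Notation hs := (mix al (a / b)).
Local Notation v := (1 + 8 * (kappa + mu ^+ 4)).
Local Notation T x := (\sum_(i in [set: I]%SET) (W i x - mu)).

(* [v] bounds [E (W i - mu)^2] and [v^2] bounds [E (W i - mu)^4]; the two summands
   bound [n] times the expectations of the two terms of [sqr_ratio_bound]. *)
Definition block_cst :=
  8 * (1 + (mu + a) ^+ 8 * nu) + 2 * v ^+ 2 / mu ^+ 4.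

Let n0 : 0 < n. Proof. by rewrite ltr0n. Qed.
Let n1 : 1 <= n. Proof. by rewrite ler1n. Qed.
Let b0 : 0 < b. Proof. by rewrite addr_gt0// mulr_gt0. Qed.
Let S0 x : 0 <= S x. Proof. by rewrite sumr_ge0. Qed.
Let Sa0 x : 0 < S x + a. Proof. by rewrite ltr_wpDl. Qed.
Let kappa0 : 0 <= kappa.
Proof.
have [i _] : exists i : I, i \in I by apply/card_gt0P.
by apply: le_trans (EW4 i); apply: Rintegral_ge0 => x _; exact: exprn_ge0.
Qed.
Let v1 : 0 <= 8 * (kappa + mu ^+ 4).
Proof. by rewrite mulr_ge0// addr_ge0// exprn_ge0// ltW. Qed.

Let IW i m : (m <= 4)%N -> L1fun P (fun x => W i x ^+ m).
Proof.
move=> m4; apply: (L1fun_expr_le m4) => //.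
by under eq_fun do rewrite ger0_norm//; exact: IW4.
Qed.

Let IW1 i : L1fun P (W i).
Proof. exact: (@IW i 1). Qed.

Let mS : measurable_fun setT (fun x => S x).
Proof. exact: measurable_sum. Qed.

Lemma block_mix_bounds x : 0 <= h x <= 1.
Proof.
have g0 : 0 <= a / (S x + a) by rewrite divr_ge0 ?ltW.
by rewrite mix_ge0//= mix_le1// ler_pdivrMr// mul1r lerDr.
Qed.

Lemma block_mix_L1fun : L1fun P (fun x => h x).
Proof.
apply: (@L1fun_bounded _ _ _ _ _ 1) => [|x].
  apply: measurableT_comp; first exact: measurable_mix.
  apply: measurable_funM => //; apply: measurable_fun_invr_ge0 => [|x].
    exact: measurable_funD.
  exact: ltW.
by have /andP[h0 h1] := block_mix_bounds x; rewrite ger0_norm.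
Qed.

Let sumT (f : I -> R) : \sum_(i in [set: I]%SET) f i = \sum_i f i.
Proof. by apply: eq_bigl => i; rewrite finset.inE. Qed.

Let IS : L1fun P (fun x => S x).
Proof. by under eq_fun do rewrite -sumT; exact: L1fun_sum. Qed.

Let ES : \int[P]_x S x = n * mu.
Proof.
under eq_Rintegral do rewrite -sumT.
by rewrite Rintegral_sum// sumT (eq_bigr (fun=> mu))// sumr_const mulr_natl.
Qed.

Let affE c d x : c + d * ((b - (S x + a)) / b) =
  (c + d * (n * mu / b)) + (- (d / b)) * S x.
Proof. by ring. Qed.

Let IS1 c d : L1fun P (fun x => c + d * ((b - (S x + a)) / b)).
Proof.
under eq_fun do rewrite affE.
by apply: L1funD; [exact: L1fun_cst|exact: L1funZ].
Qed.

(** As [S] has mean [n * mu] and [b = n * mu + a], the linear part is centered. *)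
Let ES1 c d : \int[P]_x (c + d * ((b - (S x + a)) / b)) = c.
Proof.
under eq_Rintegral do rewrite affE.
rewrite L1fun_RintegralD//; [|exact: L1fun_cst|exact: L1funZ].
by rewrite Rintegral_prob_cst L1fun_RintegralZ// ES; ring.
Qed.

Lemma block_mean_ge : hs <= \int[P]_x h x.
Proof.
(* The slope is the one in [mix_lower_bound], so [hs] becomes the integral of that lower bound. *)
rewrite -[leLHS](ES1 hs (al * (a / b) + 2 * (1 - al) * (a / b) ^+ 2)).
apply: le_L1fun_Rintegral; first exact: IS1.
  exact: block_mix_L1fun.
by move=> x; exact: mix_lower_bound.
Qed.

Let TE x : b - (S x + a) = - T x.
Proof. by rewrite sumT big_split/= sumr_const -mulr_natl; ring. Qed.

(** The centered weights satisfy [(W - mu) ^+ 4 <= 8 (W ^+ 4 + mu ^+ 4)], so their fourth moment is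
    at most [v - 1 <= v ^+ 2]. The extra 1 in [v] comes from bounding a square by 1 plus the fourth
    power. *)
Let T4 : L1fun P (fun x => T x ^+ 4) /\ \int[P]_x T x ^+ 4 <= 3 * n ^+ 2 * v ^+ 2.
Proof.
have le4 (y : R) : 0 <= y -> (y - mu) ^+ 4 <= 8 * (y ^+ 4 + mu ^+ 4).
  move=> y0.
  have h1 : (y - mu) ^+ 2 <= 2 * (y ^+ 2 + mu ^+ 2).
    by have := sqr_ge0 (y + mu); nra.
  have h2 : ((y - mu) ^+ 2) ^+ 2 <= (2 * (y ^+ 2 + mu ^+ 2)) ^+ 2.
    by rewrite ler_sqr ?nnegrE ?sqr_ge0 ?mulr_ge0 ?addr_ge0 ?sqr_ge0.
  have := sqr_ge0 (y ^+ 2 - mu ^+ 2); nra.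
have mWm i : measurable_fun setT (fun x => W i x - mu) by exact: measurable_funB.
have I8 i : L1fun P (fun x => 8 * (W i x ^+ 4 + mu ^+ 4)).
  by apply/L1funZ/L1funD => //; exact: L1fun_cst.
have E8 i : \int[P]_x (8 * (W i x ^+ 4 + mu ^+ 4)) <= 8 * (kappa + mu ^+ 4).
  rewrite L1fun_RintegralZ//; last by apply: L1funD => //; exact: L1fun_cst.
  rewrite L1fun_RintegralD//; last exact: L1fun_cst.
  by rewrite Rintegral_prob_cst ler_wpM2l// lerD2r.
have I4 i : L1fun P (fun x => (W i x - mu) ^+ 4).
  apply: L1fun_le (I8 i) _; first exact: measurable_funX.
  by move=> x; rewrite ger0_norm ?le4// (exprM _ 2 2) sqr_ge0.
have E4 i : \int[P]_x (W i x - mu) ^+ 4 <= 8 * (kappa + mu ^+ 4).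
  by apply: le_trans (E8 i); apply: le_L1fun_Rintegral => // x; exact: le4.
have I18 i : L1fun P (fun x => 1 + 8 * (W i x ^+ 4 + mu ^+ 4)).
  by apply: L1funD => //; exact: L1fun_cst.
have le2 (y : R) : 0 <= y -> (y - mu) ^+ 2 <= 1 + 8 * (y ^+ 4 + mu ^+ 4).
  move=> y0; have := le4 y y0; have := sqr_ge0 ((y - mu) ^+ 2 - 1).
  have := sqr_ge0 (y - mu); nra.
have I2 i : L1fun P (fun x => (W i x - mu) ^+ 2).
  apply: L1fun_le (I18 i) _; first exact: measurable_funX.
  by move=> x; rewrite ger0_norm ?sqr_ge0// le2.
rewrite -[#|I|]cardsT.
apply: (sum_fourth_moment (Y := fun i x => W i x - mu)) => //.
- move=> i; rewrite L1fun_RintegralB//; last exact: L1fun_cst.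
  by rewrite EW Rintegral_prob_cst subrr.
- by rewrite addr_ge0.
- move=> i; apply: (@le_trans _ _ (\int[P]_x (1 + 8 * (W i x ^+ 4 + mu ^+ 4)))).
    by apply: le_L1fun_Rintegral => // x; exact: le2.
  by rewrite L1fun_RintegralD// ?Rintegral_prob_cst ?lerD2l//; exact: L1fun_cst.
- move=> i; apply: (le_trans (E4 i)); move: v1; nra.
Qed.

(* The indicators make [rho^8 <= V] hold also where some weight vanishes, since
   there [0^-1 = 0] gives no control; this event is null. *)
Local Notation V x := (b ^+ 8 / n ^+ 9 * (\sum_(i in [set: I]%SET) (W i x)^-1 ^+ 8) +
  (b / a) ^+ 8 * \sum_(i in [set: I]%SET) \1_(W i @^-1` [set 0]) x).

Let IV : L1fun P (fun x => V x) /\ \int[P]_x V x <= (mu + a) ^+ 8 * nu.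
Proof.
have mW0 i : measurable (W i @^-1` [set 0]).
  by rewrite -[X in measurable X]setTI; exact: mW.
have I1 i : L1fun P (\1_(W i @^-1` [set 0])).
  apply: (@L1fun_bounded _ _ _ _ _ 1) => // x.
  by rewrite indicE; case: (_ \in _); rewrite ?normr1 ?normr0.
have IA : L1fun P (fun x => \sum_(i in [set: I]%SET) (W i x)^-1 ^+ 8).
  exact: L1fun_sum.
have IB : L1fun P (fun x => \sum_(i in [set: I]%SET) \1_(W i @^-1` [set 0]) x).
  exact: L1fun_sum.
split; first by apply: L1funD; exact: L1funZ.
rewrite L1fun_RintegralD ?L1fun_RintegralZ//; [|exact: L1funZ|exact: L1funZ].
rewrite !Rintegral_sum// [X in _ + _ * X]big1 ?mulr0 ?addr0; last first.
  move=> i _; transitivity (fine (P (W i @^-1` [set 0]))); last by rewrite PW0.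
  by rewrite /Rintegral integral_indic//= setIT.
have nu0 : 0 <= nu.
  have [i _] : exists i : I, i \in I by apply/card_gt0P.
  apply: le_trans (EWV8 i); apply: Rintegral_ge0 => x _.
  by rewrite exprn_ge0// invr_ge0.
apply: (@le_trans _ _ (b ^+ 8 / n ^+ 9 * (n * nu))).
  rewrite ler_wpM2l ?divr_ge0 ?exprn_ge0 ?(ltW b0)//.
  by rewrite sumT mulr_natl -sumr_const; exact: ler_sum.
(* Here [b / n = mu + a / n] is at most [mu + a] because [n >= 1]. *)
have -> : b ^+ 8 / n ^+ 9 * (n * nu) = (b / n) ^+ 8 * nu by field; rewrite gt_eqF.
rewrite ler_wpM2r// lerXn2r ?nnegrE ?(addr_ge0 (ltW mu0) (ltW a0)) ?(ltW (divr_gt0 b0 n0))//.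
by rewrite ler_pdivrMr// mulrDl [mu * n]mulrC lerD2l ler_peMr// ltW.
Qed.

(** If all weights are positive, dropping [a] from the denominator and applying Jensen gives the
    first term of [V]. If some weight is 0, its indicator is 1 and the crude bound
    [b / (S + a) <= b / a] suffices. *)
Let ratio_expr8_le x : (b / (S x + a)) ^+ 8 <= V x.
Proof.
rewrite !sumT.
have V0 : 0 <= b ^+ 8 / n ^+ 9 * (\sum_i (W i x)^-1 ^+ 8).
  rewrite mulr_ge0 ?divr_ge0 ?exprn_ge0 ?(ltW b0)// sumr_ge0// => i _.
  by rewrite exprn_ge0// invr_ge0.
have ba0 : 0 <= (b / a) ^+ 8 by rewrite exprn_ge0// divr_ge0 ?(ltW b0) ?ltW.
have [[i Wi]|Wx] := pselect (exists i, W i x = 0); last first.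
  have {}Wx i : 0 < W i x.
    by rewrite lt_neqAle W0 andbT eq_sym; apply/eqP => Wi; apply: Wx; exists i.
  rewrite [X in _ + _ * X]big1 ?mulr0 ?addr0; last first.
    by move=> i _; rewrite indicE memNset//= => Wi; have := Wx i; rewrite Wi ltxx.
  have Sx : 0 < S x.
    have [i0 _] : exists i : I, i \in I by apply/card_gt0P.
    by rewrite (bigD1 i0)//= ltr_wpDr// sumr_ge0.
  apply: (@le_trans _ _ ((b / S x) ^+ 8)).
    rewrite lerXn2r ?nnegrE ?divr_ge0 ?(ltW b0) ?(ltW Sx) ?(ltW (Sa0 x))//.
    by rewrite ler_pM2l// lef_pV2 ?posrE// lerDl ltW.
  have -> : (b / S x) ^+ 8 = b ^+ 8 / n ^+ 9 * (n ^+ 9 / S x ^+ 8).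
    by field; rewrite !gt_eqF.
  rewrite ler_wpM2l ?divr_ge0 ?exprn_ge0 ?(ltW b0)//.
  exact: jensen_expV8.
apply: (@le_trans _ _ ((b / a) ^+ 8)).
  rewrite lerXn2r ?nnegrE ?(ltW (divr_gt0 b0 a0)) ?(ltW (divr_gt0 b0 (Sa0 x)))//.
  by rewrite ler_pM2l// lef_pV2 ?posrE// lerDr.
rewrite -[leLHS]add0r lerD// ler_peMr// (bigD1 i)//= indicE mem_set//= lerDl.
by rewrite sumr_ge0.
Qed.

Lemma block_dispersion : L1fun P (fun x => (h x - hs) ^+ 2) /\
  \int[P]_x (h x - hs) ^+ 2 <= hs ^+ 2 * (block_cst / n).
Proof.
have [IT ET] := T4; have [IVx EV] := IV.
(* [B] is the bound of [sqr_ratio_bound] at [S x + a], with the eighth power of the ratio replaced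
   by [V]. *)
pose B x := 8 * (n^-1 * (1 + V x)) + n / 2 / b ^+ 4 * T x ^+ 4.
have hB x : (h x - hs) ^+ 2 <= hs ^+ 2 * B x.
  apply: (le_trans (mix_dist_bound al0 al1 a0 b0 (Sa0 x))).
  rewrite ler_wpM2l ?sqr_ge0//; apply: (le_trans (sqr_ratio_bound n0 b0 (Sa0 x))).
  rewrite TE /B lerD//.
    by rewrite ler_wpM2l// ler_wpM2l ?invr_ge0 ?(ltW n0)// lerD2l.
  rewrite le_eqVlt; apply/orP; left; apply/eqP; field.
  by rewrite gt_eqF.
have I1V : L1fun P (fun x => 1 + V x) by apply: L1funD => //; exact: L1fun_cst.
have IB : L1fun P B.
  by apply: L1funD; [apply/L1funZ/L1funZ|exact: L1funZ].
have EB : \int[P]_x B x <= block_cst / n.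
  rewrite L1fun_RintegralD; [|by apply/L1funZ/L1funZ|exact: L1funZ].
  rewrite !L1fun_RintegralZ//; last exact: L1funZ.
  rewrite L1fun_RintegralD//; last exact: L1fun_cst.
  rewrite Rintegral_prob_cst.
  have nmu0 : 0 < n * mu by rewrite mulr_gt0.
  apply: (@le_trans _ _ (8 * (n^-1 * (1 + (mu + a) ^+ 8 * nu)) +
      n / 2 / (n * mu) ^+ 4 * (3 * n ^+ 2 * v ^+ 2))).
    apply: lerD.
      by rewrite ler_wpM2l// ler_wpM2l ?invr_ge0 ?(ltW n0)// lerD2l.
    apply: ler_pM => //.
    - by rewrite !divr_ge0 ?exprn_ge0 ?(ltW n0) ?(ltW b0).
    - apply: Rintegral_ge0 => x _; by rewrite (exprM _ 2 2) sqr_ge0.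
    - rewrite ler_wpM2l ?divr_ge0 ?(ltW n0)// lef_pV2 ?posrE ?exprn_gt0//.
      by rewrite lerXn2r ?nnegrE ?(ltW nmu0) ?(ltW b0)// lerDl ltW.
  (* With [b] replaced by the smaller [n * mu], the powers of [n] reduce to [n^-1]; the factor
     [3 / 2] is then rounded up to the 2 of [block_cst]. *)
  have -> : n / 2 / (n * mu) ^+ 4 * (3 * n ^+ 2 * v ^+ 2) = (3 / 2) * (v ^+ 2 / mu ^+ 4) / n.
    by field; rewrite !gt_eqF.
  have -> : 8 * (n^-1 * (1 + (mu + a) ^+ 8 * nu)) = 8 * (1 + (mu + a) ^+ 8 * nu) / n.
    by field; rewrite !gt_eqF.
  have q0 : 0 <= v ^+ 2 / mu ^+ 4.
    by rewrite divr_ge0 ?sqr_ge0// exprn_ge0// ltW.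
  rewrite -mulrDl ler_wpM2r ?invr_ge0 ?(ltW n0)// /block_cst lerD2l -(mulrA 2).
  by apply: ler_wpM2r => //; lra.
have Ih : L1fun P (fun x => (h x - hs) ^+ 2).
  apply: L1fun_le (L1funZ (hs ^+ 2) IB) _ => [|x].
    apply: measurable_funX; apply: measurable_funB => //.
    exact: L1fun_measurable block_mix_L1fun.
  by rewrite ger0_norm ?sqr_ge0.
split => //.
apply: (@le_trans _ _ (hs ^+ 2 * \int[P]_x B x)).
  rewrite -L1fun_RintegralZ//; apply: le_L1fun_Rintegral => //.
  exact: L1funZ.
by rewrite ler_wpM2l ?sqr_ge0.
Qed.

End block_moments.

(** * Averages over independent blocks *)

(** The mean [c] minimizes the quadratic [E (f - u) ^+ 2] in [u]; the excess at [t] is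
    [(c - t) ^+ 2]. This turns the dispersion about [gs], which need not be the mean of a block,
    into a variance bound. *)
Lemma Rintegral_sqr_sub_mean_le {R : realType} {dO} {Omega : measurableType dO}
    (P : probability Omega R) (f : Omega -> R) t :
  L1fun P f -> L1fun P (fun x => f x ^+ 2) ->
  L1fun P (fun x => (f x - \int[P]_y f y) ^+ 2) /\
  \int[P]_x (f x - \int[P]_y f y) ^+ 2 <= \int[P]_x (f x - t) ^+ 2.
Proof.
move=> If If2; set c := \int[P]_y f y.
have sqE u x : (f x - u) ^+ 2 = f x ^+ 2 + ((- (2 * u)) * f x + u ^+ 2) by ring.
have I1 u : L1fun P (fun x => (- (2 * u)) * f x + u ^+ 2).
  by apply: L1funD; [exact: L1funZ|exact: L1fun_cst].
have Isq u : L1fun P (fun x => (f x - u) ^+ 2).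
  by under eq_fun do rewrite sqE; exact: L1funD.
have Esq u : \int[P]_x (f x - u) ^+ 2 = \int[P]_x f x ^+ 2 + (- (2 * u) * c + u ^+ 2).
  under eq_Rintegral do rewrite sqE.
  rewrite L1fun_RintegralD// L1fun_RintegralD; [|exact: L1funZ|exact: L1fun_cst].
  by rewrite L1fun_RintegralZ// Rintegral_prob_cst.
split; first exact: Isq.
by rewrite !Esq; have := sqr_ge0 (c - t); nra.
Qed.

Section estimator.
Context {R : realType} {dO : measure_display} {Omega : measurableType dO}.
Variable P : probability Omega R.
Context {dT : measure_display} {T : measurableType dT} {M n : nat}.
Variables (Z : 'I_M * 'I_n -> Omega -> T) (xi : T -> R).
Variables (mu kappa nu al a D : R).
Hypotheses (M0 : (0 < M)%N) (n0 : (0 < n)%N).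
Hypothesis mZ : forall i, measurable_fun setT (Z i).
Hypothesis indepZ : mutually_independent P Z.
Hypothesis mxi : measurable_fun setT xi.
Hypothesis xi0 : forall y, 0 <= xi y.
Hypothesis IW4 : forall i, L1fun P (fun x => xi (Z i x) ^+ 4).
Hypothesis EW : forall i, \int[P]_x xi (Z i x) = mu.
Hypothesis EW4 : forall i, \int[P]_x xi (Z i x) ^+ 4 <= kappa.
Hypothesis IWV8 : forall i, L1fun P (fun x => (xi (Z i x))^-1 ^+ 8).
Hypothesis EWV8 : forall i, \int[P]_x (xi (Z i x))^-1 ^+ 8 <= nu.
Hypothesis PW0 : forall i, P ((xi \o Z i) @^-1` [set 0]) = 0%E.
Hypotheses (mu0 : 0 < mu) (a0 : 0 < a) (al0 : 0 <= al) (al1 : al <= 1).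

Local Notation F m x := (mix al (a / (\sum_(j < n) xi (Z (m, j) x) + a))).
Local Notation gs := (mix al (a / (n%:R * mu + a))).
Local Notation C := (block_cst mu kappa nu a).

Let mW i : measurable_fun setT (fun x => xi (Z i x)).
Proof. exact: measurableT_comp. Qed.

(** Indices are pairs: the partial sum uses positions [(m, k)] with [k] in [J], the new term only
    [(m, i)]. *)
Let indepW m (J : {set 'I_n}) i : i \notin J ->
  indep_real P (fun x => \sum_(k in J) (xi (Z (m, k) x) - mu))
               (fun x => xi (Z (m, i) x) - mu).
Proof.
move=> iJ.
have mYk (L : {set 'I_M * 'I_n}) k : (m, k) \in L ->
    block_measurable Z L (fun x => xi (Z (m, k) x) - mu).
  move=> kL; apply: measurable_funB => //.
  exact: (measurableT_comp mxi (block_measurable_coord (X := Z) kL)).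
apply: (indep_block mZ indepZ (J := [set k | (k.1 == m) && (k.2 \in J)]%SET)
  (J' := [set (m, i)]%SET)).
- move=> k; rewrite !finset.inE => /andP[_ kJ]; apply: contra iJ => /eqP ki.
  by rewrite ki in kJ.
- apply: block_measurable_sum => k kJ.
  by apply: mYk; rewrite finset.inE eqxx.
- by apply: mYk; rewrite finset.inE.
Qed.

Let card0 : (0 < #|'I_n|)%N. Proof. by rewrite card_ord. Qed.

Let F01 m x : 0 <= F m x <= 1.
Proof. exact: (block_mix_bounds (W := fun j x => xi (Z (m, j) x))). Qed.

Let IF m : L1fun P (fun x => F m x).
Proof. exact: (block_mix_L1fun P (W := fun j x => xi (Z (m, j) x))). Qed.

Let EF m : gs <= \int[P]_x F m x.
Proof.
rewrite -[in leLHS](card_ord n).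
apply: (block_mean_ge (W := fun j x => xi (Z (m, j) x)) ) => //.
Qed.

Let VF m : L1fun P (fun x => (F m x - gs) ^+ 2) /\
  \int[P]_x (F m x - gs) ^+ 2 <= gs ^+ 2 * (C / n%:R).
Proof.
rewrite -[in n%:R](card_ord n).
apply: (block_dispersion (W := fun j x => xi (Z (m, j) x))) => //.
  exact: indepW.
by move=> j; exact: PW0.
Qed.

Let IU m : L1fun P (fun x => F m x ^+ 2).
Proof.
apply: (@L1fun_bounded _ _ _ _ _ 1) => [|x].
  exact: measurable_funX (L1fun_measurable (IF m)).
have /andP[? ?] := F01 m x.
by rewrite ger0_norm ?sqr_ge0// exprn_ile1.
Qed.

Local Notation U m x := (F m x - \int[P]_y F m y).

(** Here the disjoint index sets are unions of whole rows: the rows in [J], and row [m]. *)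
Let indepU (J : {set 'I_M}) m : m \notin J ->
  indep_real P (fun x => \sum_(k in J) U k x) (fun x => U m x).
Proof.
move=> mJ.
have mUk (L : {set 'I_M * 'I_n}) k : (forall j, (k, j) \in L) ->
    block_measurable Z L (fun x => U k x).
  move=> kL; apply: measurable_funB => //.
  apply: measurableT_comp; first exact: measurable_mix.
  apply: measurable_funM => //; apply: measurable_fun_invr_ge0.
    apply: measurable_funD => //; apply: measurable_sum => j.
    exact: (measurableT_comp mxi (block_measurable_coord (X := Z) (kL j))).
  by move=> x; rewrite addr_ge0 ?sumr_ge0// ltW.
apply: (indep_block mZ indepZ (J := [set k | k.1 \in J]%SET)
  (J' := [set k | k.1 == m]%SET)).
- by move=> k; rewrite !finset.inE => kJ; apply: contra mJ => /eqP <-.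
- apply: block_measurable_sum => k kJ.
  by apply: mUk => j; rewrite finset.inE.
- by apply: mUk => j; rewrite finset.inE.
Qed.

Lemma sum_centered_variance :
  L1fun P (fun x => (\sum_m U m x) ^+ 2) /\
  \int[P]_x (\sum_m U m x) ^+ 2 <= M%:R * (gs ^+ 2 * (C / n%:R)).
Proof.
have sumT (f : 'I_M -> R) : \sum_(i in [set: 'I_M]%SET) f i = \sum_i f i.
  by apply: eq_bigl => i; rewrite finset.inE.
have IU1 m : L1fun P (fun x => U m x).
  have := L1funD (IF m) (L1fun_cst P (- \int[P]_y F m y)); exact.
have [||||_ I2 _ E2] := sum_second_moment (P := P) (Y := fun m x => U m x)
  (v := gs ^+ 2 * (C / n%:R)) indepU _ _ _ _ [set: 'I_M]%SET.
- by move=> m; exact: L1fun_measurable (IU1 m).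
- move=> m; rewrite L1fun_RintegralB//; last exact: L1fun_cst.
  by rewrite Rintegral_prob_cst subrr.
- by move=> m; case: (Rintegral_sqr_sub_mean_le 0 (IF m) (IU m)).
- move=> m; have [_ h] := Rintegral_sqr_sub_mean_le gs (IF m) (IU m).
  exact: le_trans h (VF m).2.
split; first by under eq_fun do rewrite -sumT.
under eq_Rintegral do rewrite -sumT.
by move: E2; rewrite cardsT card_ord.
Qed.

(** The mean and the standard deviation both carry the factor [|D| / M], so the claim compares the
    sum of block means, at least [M * gs], with a variance of order [M / n]. The parameter [k] is
    kept apart from [n] because the rate is stated in [K] while a block has [K - 1] samples. *)
Lemma SNR_estimator_ge (c k : R) : D != 0 -> 0 <= c -> 0 <= k ->
  c ^+ 2 * k * C <= n%:R ->
  ((c * Num.sqrt (M%:R * k))%:E <=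
    SNR P (fun x => M%:R^-1 * \sum_(m < M) (F m x * D))%R)%E.
Proof.
move=> Dn0 c0 k0 hc; rewrite /SNR.
have MR0 : 0 < M%:R :> R by rewrite ltr0n.
have nR0 : 0 < n%:R :> R by rewrite ltr0n.
have gs0 : 0 < gs.
  have g0 : 0 < a / (n%:R * mu + a).
    by rewrite divr_gt0// addr_gt0// mulr_gt0.
  (* At [al = 1] the linear term of [mix] is the positive one; otherwise the quadratic term is. *)
  rewrite /mix; have [al10|al10] := eqVneq al 1.
    by rewrite al10 subrr mul0r addr0 mul1r.
  apply: ltr_wpDl; first exact: mulr_ge0 (ltW g0).
  by apply: mulr_gt0; rewrite ?exprn_gt0// subr_gt0 lt_neqAle al10.
set X := (X in expectation P X); set e := fine (expectation P X).
set w := fine (variance P X).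
pose s := \sum_(m < M) \int[P]_y F m y.
have sumT (f : 'I_M -> R) : \sum_(i in [set: 'I_M]%SET) f i = \sum_i f i.
  by apply: eq_bigl => i; rewrite finset.inE.
have IsF : L1fun P (fun x => \sum_m F m x).
  by under eq_fun do rewrite -sumT; exact: L1fun_sum.
have XE x : X x = (D / M%:R) * \sum_m F m x.
  by rewrite /X -mulr_suml; ring.
have eI : fine (\int[P]_x (X x)%:E)%E = D / M%:R * s.
  rewrite -[LHS]/(\int[P]_x X x)%R.
  under eq_Rintegral do rewrite XE.
  rewrite L1fun_RintegralZ//; congr (_ * _).
  under eq_Rintegral do rewrite -sumT.
  by rewrite Rintegral_sum// sumT.
have eE : e = D / M%:R * s by rewrite -eI /e expectation.unlock.
have [IU2 EU2] := sum_centered_variance.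
have wE : w = (D / M%:R) ^+ 2 * \int[P]_x (\sum_m U m x) ^+ 2.
  rewrite -L1fun_RintegralZ// /w /variance covariance.unlock expectation.unlock; congr fine.
  apply: eq_integral => x _; congr EFin.
  rewrite [LHS](_ : _ = (X x - fine (\int[P]_x (X x)%:E)%E) ^+ 2)// eI XE /s sumrB; ring.
have hs_s : M%:R * gs <= s.
  rewrite -[X in X%:R * _](card_ord M) mulr_natl -sumr_const.
  by apply: ler_sum => m _; exact: EF.
(* A vanishing variance makes the ratio infinite by definition; otherwise the inequality is
   squared. *)
case: ifPn => [w0|_]; last exact: leey.
rewrite lee_fin ler_pdivlMr ?sqrtr_gt0//.
rewrite -ler_sqr ?nnegrE ?mulr_ge0 ?sqrtr_ge0//.
rewrite !exprMn real_normK ?num_real// !sqr_sqrtr ?mulr_ge0 ?(ltW w0) ?(ltW MR0)//.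
have D20 : 0 <= (D / M%:R) ^+ 2 by rewrite sqr_ge0.
(* Once the variance bound is inserted, what remains is [c ^+ 2 * k * C / n <= 1] together with
   [M * gs <= s]. *)
apply: (@le_trans _ _ (c ^+ 2 * (M%:R * k) * ((D / M%:R) ^+ 2 * (M%:R * (gs ^+ 2 * (C / n%:R)))))).
  rewrite wE ler_wpM2l ?mulr_ge0 ?sqr_ge0 ?(ltW MR0)//.
  exact: ler_wpM2l.
rewrite eE [leRHS]exprMn.
have -> : c ^+ 2 * (M%:R * k) * ((D / M%:R) ^+ 2 * (M%:R * (gs ^+ 2 * (C / n%:R)))) =
  (D / M%:R) ^+ 2 * ((c ^+ 2 * k * C / n%:R) * (M%:R * gs) ^+ 2) by ring.
rewrite ler_wpM2l//.
have Mgs0 : 0 <= M%:R * gs by rewrite mulr_ge0 ?ltW.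
apply: (@le_trans _ _ ((M%:R * gs) ^+ 2)).
  by rewrite ler_piMl ?sqr_ge0// ler_pdivrMr// mul1r.
by rewrite ler_sqr ?nnegrE// (le_trans Mgs0).
Qed.

End estimator.

(** * Laws with a density *)

Section density_law.
Context (R : realType) (d : nat) (lam : {measure set (Rd R d) -> \bar R}).
Context dO (Omega : measurableType dO) (P : probability Omega R).
Variables (q : 'rV[R]_d -> R) (X : Omega -> Rd R d).
Hypotheses (q0 : forall y, 0 <= q y) (mq : measurable_fun setT (q : Rd R d -> R)).
Hypothesis lawX : has_density_law P lam q X.

Import HBNNSimple.

(** Increasing simple functions approximate [f]; monotone convergence on both sides reduces the
    identity to indicators, where it is the definition of the law. *)
Lemma ge0_integral_density_law (f : Rd R d -> R) :
  measurable_fun setT f -> (forall y, 0 <= f y) ->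
  (\int[P]_om (f (X om))%:E = \int[lam]_y (q y * f y)%:E)%E.
Proof.
case: lawX => mX PX mf f0.
have mfE : measurable_fun [set: Rd R d] (fun y => (f y)%:E) by exact/measurable_EFinP.
pose f_ := nnsfun_approx measurableT mfE.
have f_cvg y : EFin \o f_^~ y @ \oo --> (f y)%:E.
  by apply: (cvg_nnsfun_approx measurableT mfE) => // x _; rewrite lee_fin.
have f_nd m n y : (m <= n)%N -> f_ m y <= f_ n y.
  by move=> mn; exact/lefP/nd_nnsfun_approx.
transitivity (limn (fun n => \int[P]_om (f_ n (X om))%:E)%E).
  rewrite -monotone_convergence//.
  - by apply: eq_integral => om _; apply/esym/cvg_lim => //; exact: f_cvg.
  - by move=> n; apply/measurable_EFinP; exact: measurableT_comp.
  - by move=> n om _; rewrite lee_fin.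
  - by move=> om _ m n mn; rewrite lee_fin f_nd.
transitivity (limn (fun n => \int[lam]_y (q y * f_ n y)%:E)%E); last first.
  rewrite -monotone_convergence//.
  - apply: eq_integral => y _; apply/cvg_lim => //.
    under eq_fun do rewrite EFinM.
    rewrite EFinM; apply: cvgeZl => //; exact: f_cvg.
  - by move=> n; apply/measurable_EFinP; exact: measurable_funM.
  - by move=> n y _; rewrite lee_fin mulr_ge0.
  - by move=> y _ m n mn; rewrite lee_fin ler_wpM2l// f_nd.
congr (limn _); apply/funext => n.
have mpre k : measurable (f_ n @^-1` [set k]) by exact: measurable_funPTI.
transitivity (\sum_(k \in range (f_ n))
    \int[P]_om (k * \1_(f_ n @^-1` [set k]) (X om))%:E)%E.
  rewrite -ge0_integral_fsum//.
  - by apply: eq_integral => om _; rewrite fsumEFin// -fimfunE.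
  - move=> k; apply/measurable_EFinP; apply: measurable_funM => //.
    by apply: (measurableT_comp _ mX).
  - by move=> k om _; rewrite EFinM nnfun_muleindic_ge0.
transitivity (\sum_(k \in range (f_ n))
    \int[lam]_y (q y * (k * \1_(f_ n @^-1` [set k]) y))%:E)%E; last first.
  rewrite -ge0_integral_fsum//.
  - apply: eq_integral => y _; rewrite fsumEFin// [in RHS]fimfunE.
    congr EFin. rewrite fsbig_finite//= fsbig_finite//= mulr_sumr//.
  - move=> k.  apply/measurable_EFinP; do 2 apply: measurable_funM => //.
  - by move=> k y _; rewrite EFinM mule_ge0 ?lee_fin// -lee_fin EFinM nnfun_muleindic_ge0.
apply: eq_fsbigr => k _.
(* A negative value of a nonnegative simple function has empty preimage, so both sides vanish. *)
have [k0|k0] := leP 0 k; last first.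
  rewrite preimage_nnfun0// indic0 !integral0_eq// => ? _; by rewrite ?mulr0.
under eq_integral do rewrite EFinM.
rewrite ge0_integralZl//; last first.
  by apply/measurable_EFinP; apply: (measurableT_comp _ mX).
under [RHS]eq_integral do rewrite mulrCA EFinM.
rewrite ge0_integralZl//; last 2 first.
- by apply/measurable_EFinP; exact: measurable_funM.
- by move=> y _; rewrite lee_fin mulr_ge0.
congr (_ * _)%E.
transitivity (P (X @^-1` (f_ n @^-1` [set k]))).
  rewrite -[X in P X]setIT -integral_indic//.
  by rewrite -[X in measurable X]setTI; exact: mX.
rewrite PX// [LHS]integral_mkcond; apply: eq_integral => y _.
by rewrite patchE indicE; case: ifP; rewrite ?mulr1 ?mulr0.
Qed.

End density_law.

Lemma continuous_measurable_Rd {R : realType} {d : nat} (f : 'rV[R]_d -> R) :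
  continuous f -> measurable_fun [set: Rd R d] f.
Proof.
move=> /continuousP cf; apply: (measurability _ (RGenOpens.measurableE R)).
move=> _ [_ [x [y ->]] <-]; rewrite setTI; apply: sub_sigma_algebra.
exact/cf/interval_open.
Qed.

(** * Finiteness and positivity of moments under the density *)

Section density.
Context (R : realType) (d : nat) (lam : {measure set (Rd R d) -> \bar R}).
Variables (q : 'rV[R]_d -> R).
Hypothesis densq : is_prob_density lam q.

Let q0 y : 0 <= q y. Proof. by case: densq. Qed.
Let mq : measurable_fun [set: Rd R d] q. Proof. by case: densq. Qed.

(** The constant 1 integrates to 1 against [q]; this passes from a higher moment to a lower one. *)
Lemma density_integral_lty_le (f g : Rd R d -> R) :
  measurable_fun setT f -> measurable_fun setT g ->
  (forall y, 0 <= f y) -> (forall y, f y <= 1 + g y) -> (forall y, 0 <= g y) ->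
  (\int[lam]_y (q y * g y)%:E < +oo)%E -> (\int[lam]_y (q y * f y)%:E < +oo)%E.
Proof.
move=> mf mg f0 fg g0 gy; have [_ _ q1] := densq.
apply: (@le_lt_trans _ _ (\int[lam]_y ((q y)%:E + (q y * g y)%:E)%E)%E).
  apply: ge0_le_integral => //.
  - by move=> y _; rewrite lee_fin mulr_ge0.
  - by apply/measurable_EFinP; exact: measurable_funM.
  - apply: emeasurable_funD; apply/measurable_EFinP => //.
    exact: measurable_funM.
  - by move=> y _; rewrite -EFinD lee_fin -[X in X + _]mulr1 -mulrDr ler_wpM2l.
rewrite ge0_integralD//.
- by rewrite q1 lte_add_pinfty// ltry.
- by move=> y _; rewrite lee_fin.
- exact/measurable_EFinP.
- by move=> y _; rewrite lee_fin mulr_ge0.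
- by apply/measurable_EFinP; exact: measurable_funM.
Qed.

(** A zero integral would force [q * f = 0], hence [q = 0], almost everywhere, against total mass
    1. *)
Lemma density_integral_gt0 (f : Rd R d -> R) :
  measurable_fun setT f -> (forall y, 0 <= f y) ->
  (forall y, f y = 0 -> q y = 0) ->
  (\int[lam]_y (q y * f y)%:E < +oo)%E -> 0 < \int[lam]_y (q y * f y).
Proof.
move=> mf f0 fq fy; have [_ _ q1] := densq.
have qf0 : (0 <= \int[lam]_y (q y * f y)%:E)%E.
  by apply: integral_ge0 => y _; rewrite lee_fin mulr_ge0.
rewrite lt_neqAle fine_ge0// andbT; apply/eqP => /esym h.
have mqf : measurable_fun [set: Rd R d] (fun y => (q y * f y)%:E).
  by apply/measurable_EFinP; exact: measurable_funM.
have i0 : (\int[lam]_y (q y * f y)%:E = 0)%E.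
  by rewrite -[LHS]fineK ?ge0_fin_numE//; congr EFin.
have /(ae_eq_integral_abs lam measurableT mqf) ae0 :
    (\int[lam]_y `|(q y * f y)%:E| = 0)%E.
  rewrite -[RHS]i0; apply: eq_integral => y _.
  by rewrite gee0_abs// lee_fin mulr_ge0.
have : (\int[lam]_y (q y)%:E = \int[lam]_y 0%:E)%E.
  apply: ge0_ae_eq_integral => //; first exact/measurable_EFinP.
    by move=> y _; rewrite lee_fin.
  apply: filterS ae0 => y /(_ I)[] /eqP.
  by rewrite mulf_eq0 => /orP[/eqP qy|/eqP/fq qy] _; rewrite qy.
by rewrite q1 integral0 => -[] /eqP; rewrite oner_eq0.
Qed.

Context dO (Omega : measurableType dO) (P : probability Omega R).
Variables (X : Omega -> Rd R d).
Hypothesis lawX : has_density_law P lam q X.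

Lemma density_law_L1fun (f : Rd R d -> R) :
  measurable_fun setT f -> (forall y, 0 <= f y) ->
  (\int[lam]_y (q y * f y)%:E < +oo)%E ->
  L1fun P (fun x => f (X x)) /\ \int[P]_x f (X x) = \int[lam]_y (q y * f y).
Proof.
move=> mf f0 fy; have E := ge0_integral_density_law q0 mq lawX mf f0.
split; last by rewrite /Rintegral E.
apply/integrableP; split.
  by apply/measurable_EFinP; apply: (measurableT_comp mf); case: lawX.
under eq_integral => x _ do rewrite /= ger0_norm//.
by rewrite E.
Qed.

End density.

(** * From the moment assumptions to the rate *)

Unset Implicit Arguments.
Set Strict Implicit.

Theorem theorem2 (R : realType) (d : nat)
    (lam : {measure set (Rd R d) -> \bar R})
    (pxz q : 'rV[R]_d -> R) (alpha : R) (z : 'rV[R]_d) (r : 'I_d) :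
  is_lebesgue_Rd lam ->
  (forall y, 0 < pxz y) ->
  (forall y, differentiable pxz y) ->
  is_prob_density lam q ->
  0 <= alpha < 1 ->
  (\int[lam]_y (q y * iw pxz q y `^ (4 * (1 - alpha)))%:E < +oo)%E ->
  (\int[lam]_y (q y * iw pxz q y `^ (- (12 * (1 - alpha))))%:E < +oo)%E ->
  0 < iw pxz q z ->
  derivable (fun y => ln (iw pxz q y)) z (delta_mx ord0 r) ->
  'D_(delta_mx ord0 r) (fun y => ln (iw pxz q y)) z != 0 ->
  exists c : R, 0 < c /\ exists K0 : nat,
    forall M K : nat, (0 < M)%N -> (0 < K)%N -> (K0 <= K)%N ->
    forall (dO : measure_display) (Omega : measurableType dO)
           (P : probability Omega R) (Z : 'I_M * 'I_K.-1 -> Omega -> Rd R d),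
      (forall i, has_density_law P lam q (Z i)) ->
      mutually_independent P Z ->
      ((c * Num.sqrt (M%:R * K%:R))%:E <= SNR P (vr_grad_estimator pxz q alpha z r Z))%E.
Proof.
move=> _ p0 dp densq /andP[al0 al1] I4 I12 wz _ Dn0.
have [q0 mq q1] := densq.
pose xi (y : Rd R d) : R := iw pxz q y `^ (1 - alpha).
have w0 y : 0 <= iw pxz q y by rewrite divr_ge0// ltW.
have mxi : measurable_fun setT xi.
  apply: (measurableT_comp (f := fun t : R => t `^ (1 - alpha))) => //.
  apply: measurable_funM; last exact: measurable_fun_invr_ge0.
  apply: continuous_measurable_Rd => y.
  exact/differentiable_continuous/dp.
have xi0 y : 0 <= xi y by exact: powR_ge0.
(* As [pxz] is positive, [xi] vanishes only through the convention that division by 0 gives 0, that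
   is, where [q] is 0. Such points carry no mass. *)
have xi_eq0 y : xi y = 0 -> q y = 0.
  move=> /eqP; rewrite powR_eq0 => /andP[+ _].
  by rewrite mulf_eq0 invr_eq0 gt_eqF//= => /eqP.
have mxi4 : measurable_fun setT (fun y => xi y ^+ 4) by exact: measurable_funX.
have mxiV : measurable_fun setT (fun y => (xi y)^-1).
  exact: measurable_fun_invr_ge0.
have F4 : (\int[lam]_y (q y * xi y ^+ 4)%:E < +oo)%E.
  have E4 y : xi y ^+ 4 = iw pxz q y `^ (4 * (1 - alpha)).
    by rewrite -powR_mulrn// -powRrM mulrC.
  under eq_integral => y _ do rewrite E4; exact: I4.
have FV12 : (\int[lam]_y (q y * (xi y)^-1 ^+ 12)%:E < +oo)%E.
  have E12 y : (xi y)^-1 ^+ 12 = iw pxz q y `^ (- (12 * (1 - alpha))).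
    by rewrite exprVn -powR_mulrn// -powRrM -powRN mulrC.
  under eq_integral => y _ do rewrite E12; exact: I12.
have F1 : (\int[lam]_y (q y * xi y)%:E < +oo)%E.
  apply: density_integral_lty_le F4 => // y; last exact: exprn_ge0.
  have := xi0 y; have := sqr_ge0 (xi y ^+ 2 - 1); have := sqr_ge0 (xi y - 1).
  nra.
(* Jensen's bound calls for the inverse eighth moment, dominated by 1 plus the inverse twelfth. *)
have FV8 : (\int[lam]_y (q y * (xi y)^-1 ^+ 8)%:E < +oo)%E.
  have V0 y : 0 <= (xi y)^-1 by rewrite invr_ge0.
  apply: density_integral_lty_le FV12 => //; try exact: measurable_funX.
  - by move=> y; exact: exprn_ge0.
  - move=> y; have [h|h] := leP (xi y)^-1 1.
      by rewrite (le_trans (exprn_ile1 8 (V0 y) h))// lerDl exprn_ge0.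
    have h8 : (xi y)^-1 ^+ 8 <= (xi y)^-1 ^+ 12 by rewrite ler_weXn2l// ltW.
    by rewrite (le_trans h8)// lerDr.
  - by move=> y; exact: exprn_ge0.
pose mu := \int[lam]_y (q y * xi y).
pose kappa := \int[lam]_y (q y * xi y ^+ 4).
pose nu := \int[lam]_y (q y * (xi y)^-1 ^+ 8).
have mu0 : 0 < mu by exact: density_integral_gt0.
pose a := xi z.
have a0 : 0 < a by rewrite powR_gt0.
pose C := block_cst mu kappa nu a.
have C0 : 0 < C.
  have nu0 : 0 <= nu.
    apply: Rintegral_ge0 => y _.
    by rewrite mulr_ge0// exprn_ge0// invr_ge0.
  rewrite /C /block_cst ltr_wpDr//.
    by rewrite divr_ge0 ?exprn_ge0 ?(ltW mu0)// mulr_ge0// sqr_ge0.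
  by rewrite mulr_gt0// ltr_wpDr// mulr_ge0// exprn_ge0// addr_ge0// ltW.
(* With this [c], [c ^+ 2 * K * C = K / 2], which is at most the block size [K - 1] once [K >= 2].
   The constant depends on neither [M], [K] nor the probability space. *)
exists (Num.sqrt (2 * C))^-1; split; first by rewrite invr_gt0 sqrtr_gt0 mulr_gt0.
exists 2%N => M K M0 _ K2 dO Omega P Z lawZ indepZ.
have n0 : (0 < K.-1)%N by rewrite -ltnS prednK// (leq_trans _ K2).
apply: (SNR_estimator_ge (xi := xi) (mu := mu) (kappa := kappa) (nu := nu)) => //.
- by move=> i; case: (lawZ i).
- move=> i; case: (density_law_L1fun densq (lawZ i) mxi4) => // y.
  exact: exprn_ge0.
- by move=> i; case: (density_law_L1fun densq (lawZ i) mxi).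
- move=> i; case: (density_law_L1fun densq (lawZ i) mxi4) => // [y|_ ->//].
  exact: exprn_ge0.
- move=> i; case: (@density_law_L1fun _ _ _ _ densq _ _ _ _ (lawZ i)
      (fun y => (xi y)^-1 ^+ 8)) => //; first exact: measurable_funX.
  by move=> y; rewrite exprn_ge0// invr_ge0.
- move=> i; case: (@density_law_L1fun _ _ _ _ densq _ _ _ _ (lawZ i)
      (fun y => (xi y)^-1 ^+ 8)) => //; first exact: measurable_funX.
    by move=> y; rewrite exprn_ge0// invr_ge0.
  by move=> _ ->.
(* The probability of a zero weight is the integral of [q] over a set where [q] vanishes. *)
- move=> i; rewrite comp_preimage (lawZ i).2; last first.
    by rewrite -[X in measurable X]setTI; exact: mxi.
  by apply: integral0_eq => y /= /xi_eq0 ->.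
- exact: ltW.
- rewrite exprVn sqr_sqrtr ?mulr_ge0 ?(ltW C0)//.
  rewrite -/C (_ : _ * _ * C = K%:R / 2); last by field; rewrite gt_eqF.
  rewrite ler_pdivrMr// -natrM ler_nat -(@prednK K) ?(leq_trans _ K2)//=.
  by rewrite muln2 -addnn -addn1 leq_add2l.
Qed.
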